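(* Let $q\geq3$ and let $[b_1,b_2,\dots]_q$ be an infinite Rosen continued fraction. If no point of $\mathbb{R}\cup\{\infty\}$ occurs infinitely often in its sequence of convergents, then the continued fraction converges.
   Context: Let $\lambda_q=2\cos(\pi/q)$. For an infinite sequence of integers $b_1,b_2,\dots$ set $s_i(z)=b_i\lambda_q-1/z$. The convergents of the infinite Rosen continued fraction $[b_1,b_2,\dots]_q$ are $v_m=s_1\circ\dots\circ s_m(\infty)\in\mathbb{R}\cup\{\infty\}$, $m=1,2,\dots$; the continued fraction converges if $(v_m)$ converges in $\mathbb{R}\cup\{\infty\}$ (with its topology as a circle / one-point compactification). *)

(* Defs.v *)
From HB Require Import structures.
From mathcomp Require Import all_boot all_order all_algebra.
From mathcomp Require Import all_classical all_reals all_analysis.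

Set Implicit Arguments.
Unset Strict Implicit.
Unset Printing Implicit Defensive.

Import Order.TTheory GRing.Theory Num.Theory.
Import numFieldNormedType.Exports.

Local Open Scope classical_set_scope.
Local Open Scope ring_scope.

Definition rosen_lambda (R : realType) (q : nat) : R := 2 * cos (pi / q%:R).

(* The map z |-> b * lambda_q - 1/z on R u {oo}: [None] is the point oo, with
   the usual conventions 1/oo = 0, 1/0 = oo and c - oo = oo for c in R. *)
Definition rosen_map (R : realType) (q : nat) (b : int)
    (z : one_point_compactification R) : one_point_compactification R :=
  match z with
  | None => Some (b%:~R * rosen_lambda R q)
  | Some x => if x == 0 then None else Some (b%:~R * rosen_lambda R q - 1 / x)
  end.

(* s_1 o ... o s_m (oo).  Coefficients are indexed from 1: the value [b 0] is
   never used. *)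
Definition rosen_convergent (R : realType) (q : nat) (b : nat -> int)
    (m : nat) : one_point_compactification R :=
  (\big[(fun f g => f \o g)/idfun]_(1 <= i < m.+1) rosen_map q (b i)) None.

(* Only the convergents with m >= 1 count; the limit is taken along m -> oo, so
   the extra value [rosen_convergent R q b 0] is harmless. *)
Definition rosen_converges (R : realType) (q : nat) (b : nat -> int) : Prop :=
  cvg (rosen_convergent R q b @ \oo).

Definition occurs_infinitely_often (R : realType) (q : nat) (b : nat -> int)
    (x : one_point_compactification R) : Prop :=
  infinite_set [set m | (0 < m)%N /\ rosen_convergent R q b m = x].

(* Main.v *)
(* Consecutive convergents are neighbours in the Farey graph of the Hecke group,
   whose vertices are the orbit of oo and whose edges are the images of the pair
   {0, oo}.  Edges do not cross, so once the path of convergents has left the two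
   endpoints of an edge for good, it stays in one of the two arcs of the circle
   that the edge cuts off.  Using the edges {oo, j lambda}, either the convergents
   tend to oo, or they are trapped between two consecutive multiples of lambda;
   then subdividing repeatedly along ideal q-gons traps them in arcs
   (b/d, a/c) with c, d >= 1 and c + d arbitrarily large, whose length 1/(cd)
   tends to 0. *)
Require Import Defs.
From mathcomp Require Import all_boot all_order all_algebra.
From mathcomp Require Import all_classical all_reals all_analysis.
From mathcomp Require Import ring lra.

Set Implicit Arguments.
Unset Strict Implicit.
Unset Printing Implicit Defensive.

Import Order.TTheory GRing.Theory Num.Theory.
Import numFieldNormedType.Exports.

(** * Two-by-two matrices over a commutative ring *)

Section TwoByTwo.
Local Open Scope ring_scope.
Variable R : comPzRingType.
Implicit Types A B : 'M[R]_2.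

Definition mat2 (a b c d : R) : 'M[R]_2 :=
  \matrix_(i, j) if i == 0 then (if j == 0 then a else b)
                 else (if j == 0 then c else d).

Lemma mat2E a b c d :
  ((mat2 a b c d 0 0 = a) * (mat2 a b c d 0 1 = b) *
   (mat2 a b c d 1 0 = c) * (mat2 a b c d 1 1 = d))%type.
Proof. by rewrite !mxE. Qed.

Lemma mat2_eta A : A = mat2 (A 0 0) (A 0 1) (A 1 0) (A 1 1).
Proof.
by apply/matrixP => -[[|[|//]] i] -[[|[|//]] j]; rewrite mxE /=;
  congr (A _ _); apply: val_inj.
Qed.

Lemma mul_mat2 a b c d a' b' c' d' :
  mat2 a b c d *m mat2 a' b' c' d' =
  mat2 (a * a' + b * c') (a * b' + b * d') (c * a' + d * c') (c * b' + d * d').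
Proof.
by rewrite [LHS]mat2_eta !mxE !big_ord_recl !big_ord0 !mxE /= !addr0.
Qed.

Lemma opp_mat2 a b c d : - mat2 a b c d = mat2 (- a) (- b) (- c) (- d).
Proof. by rewrite [LHS]mat2_eta !mxE. Qed.

Lemma mat2_1 : 1%:M = mat2 1 0 0 1.
Proof. by rewrite [LHS]mat2_eta !mxE. Qed.

Definition det2 A := A 0 0 * A 1 1 - A 0 1 * A 1 0.

Definition adj2 A := mat2 (A 1 1) (- A 0 1) (- A 1 0) (A 0 0).

Lemma det2M A B : det2 (A *m B) = det2 A * det2 B.
Proof.
by rewrite (mat2_eta A) (mat2_eta B) mul_mat2 /det2 !mat2E; ring.
Qed.

Lemma adj2M A B : adj2 (A *m B) = adj2 B *m adj2 A.
Proof.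
rewrite (mat2_eta A) (mat2_eta B) mul_mat2 /adj2 !mat2E mul_mat2.
by congr mat2; ring.
Qed.

Lemma mul_adj2 A : det2 A = 1 -> A *m adj2 A = 1%:M.
Proof.
rewrite (mat2_eta A) /det2 /adj2 !mat2E mul_mat2 mat2_1 => <-.
by congr mat2; ring.
Qed.

End TwoByTwo.

(** * Sine ratios, the Hecke group and its Farey graph *)

Section HeckeGroup.
Local Open Scope ring_scope.
Variables (R : realType) (q : nat).
Hypothesis hq : (3 <= q)%N.
Implicit Types A P : 'M[R]_2.

Local Notation lam := (rosen_lambda R q).
Let th : R := pi / q%:R.

(** The Chebyshev values U_{k-1}(lambda/2), which are up to sign the entries of the powers of
    [UM]. *)
Definition sin_ratio (k : nat) : R := sin (k%:R * (pi / q%:R)) / sin (pi / q%:R).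
Local Notation s := sin_ratio.

Let q_gt0 : (0 : R) < q%:R.
Proof. by rewrite ltr0n (leq_trans _ hq). Qed.

Let sin_th_gt0 : 0 < sin th.
Proof.
apply: sin_gt0_pi; rewrite divr_gt0 ?pi_gt0 //= ltr_pdivrMr //.
by rewrite ltr_pMr ?pi_gt0 // ltr1n (leq_trans _ hq).
Qed.

Lemma sin_ratio0 : s 0 = 0.
Proof. by rewrite /s mul0r sin0 mul0r. Qed.

Lemma sin_ratio1 : s 1 = 1.
Proof. by rewrite /s mul1r divff // gt_eqF. Qed.

Lemma sin_ratio_q : s q = 0.
Proof. by rewrite /s [_ * (_ / _)]mulrC divfK ?gt_eqF // sinpi mul0r. Qed.

Lemma sin_ratioSS k : s k.+2 = lam * s k.+1 - s k.
Proof.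
rewrite /s /rosen_lambda -/th.
have -> : k.+2%:R * th = k.+1%:R * th + th by rewrite -[k.+2]addn1 natrD; ring.
have -> : k%:R * th = k.+1%:R * th - th by rewrite -[k.+1]addn1 natrD; ring.
by rewrite sinD sinB mulrA -mulrBl; congr (_ / _); ring.
Qed.

Lemma sin_ratio_ge0 k : (k <= q)%N -> 0 <= s k.
Proof.
move=> kq; rewrite /s -/th mulr_ge0 ?invr_ge0 ?(ltW sin_th_gt0) //.
apply: sin_ge0_pi; rewrite /th mulr_ge0 ?divr_ge0 ?pi_ge0 ?ler0n //=.
by rewrite mulrCA ler_piMr ?pi_ge0 // ler_pdivrMr // mul1r ler_nat.
Qed.

(** The left side is the determinant of [PM k]; the recurrence makes it independent of k. *)
Lemma sin_ratio_det k : s k.+1 * s k.+1 - s k.+2 * s k = 1.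
Proof.
elim: k => [|k IH]; first by rewrite sin_ratio0 sin_ratio1; ring.
by rewrite -IH (sin_ratioSS k.+1) (sin_ratioSS k); ring.
Qed.

(** By the determinant identity the square is 1 plus a product of two nonnegative terms. This bound
    drives the growth of denominators in [zoom]. *)
Lemma sin_ratio_ge1 k : (k.+1 < q)%N -> 1 <= s k.+1.
Proof.
move=> kq; rewrite -(ler_sqr ler01) ?nnegrE ?sin_ratio_ge0 ?(ltnW kq) //.
rewrite expr1n expr2 -(sin_ratio_det k) lerBlDr lerDl mulr_ge0 //.
  exact: sin_ratio_ge0.
by rewrite sin_ratio_ge0 // (leq_trans (leq_addr 2 k)) // addn2.
Qed.

(** * Generators of the Hecke group and normal forms of its elements *)

Definition SM : 'M[R]_2 := mat2 0 (-1) 1 0.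
Definition UM : 'M[R]_2 := mat2 lam (-1) 1 0.

Definition TM (c : int) : 'M[R]_2 := mat2 1 (c%:~R * lam) 0 1.

(* [PM k = U^(k+1) S^-1] maps the arc (0, oo) to one of the q-1 arcs into which
   it is cut by the ideal q-gon with vertices U^k(oo). *)
Definition PM (k : nat) : 'M[R]_2 := mat2 (s k.+1) (s k.+2) (s k) (s k.+1).

Lemma SM_SM : SM *m SM = - 1%:M.
Proof. by rewrite mul_mat2 mat2_1 opp_mat2; congr mat2; ring. Qed.

Lemma PM0_SM : PM 0 *m SM = UM.
Proof.
rewrite mul_mat2; congr mat2; rewrite ?(sin_ratioSS 0) ?sin_ratio0 ?sin_ratio1;
  ring.
Qed.

Lemma PM_SM_UM k : PM k *m SM *m UM = PM k.+1 *m SM.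
Proof.
by rewrite !mul_mat2; congr mat2; rewrite ?(sin_ratioSS k.+1) ?(sin_ratioSS k);
  ring.
Qed.

Lemma sin_ratio_pred : s q.-1 = 1.
Proof.
case: q hq sin_ratio_q (@sin_ratio_ge0) (@sin_ratio_det) => // -[//|p] _ sq ge0 det.
have /eqP := det p; rewrite sq mul0r subr0 -expr2 sqrf_eq1.
case/orP=> /eqP //= e; move: (ge0 p.+1 (leqnSn _)); rewrite e.
by rewrite leNgt ltrN10.
Qed.

(** Since [PM k *m SM] is U^(k+1), this is the relation U^q = -1, which closes the q-gon. *)
Lemma PM_last_SM : PM q.-1 *m SM = - 1%:M.
Proof.
have qE : q.-1.+1 = q by rewrite prednK // (leq_trans _ hq).
rewrite mul_mat2 mat2_1 opp_mat2; congr mat2;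
  rewrite ?(sin_ratioSS q.-1) ?qE ?sin_ratio_pred ?sin_ratio_q; ring.
Qed.

(** Words are built by right multiplication only, without inverses of generators; [hecke_adj]
    recovers inverses, since the determinant is 1. *)
Inductive hecke : 'M[R]_2 -> Prop :=
| hecke1 : hecke 1%:M
| heckeN A : hecke A -> hecke (- A)
| heckeMS A : hecke A -> hecke (A *m SM)
| heckeMU A : hecke A -> hecke (A *m UM).

Lemma heckeM A B : hecke A -> hecke B -> hecke (A *m B).
Proof.
move=> hA; elim=> [|{}B _|{}B _|{}B _].
- by rewrite mulmx1.
- by rewrite mulmxN => /heckeN.
- by rewrite mulmxA => /heckeMS.
- by rewrite mulmxA => /heckeMU.
Qed.

Lemma hecke_SM : hecke SM.
Proof. by rewrite -[SM]mul1mx; apply/heckeMS/hecke1. Qed.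

Lemma hecke_UM : hecke UM.
Proof. by rewrite -[UM]mul1mx; apply/heckeMU/hecke1. Qed.

Lemma hecke_PM k : hecke (PM k).
Proof.
suff h : hecke (PM k *m SM).
  have -> : PM k = - (PM k *m SM *m SM).
    by rewrite -mulmxA SM_SM mulmxN mulmx1 opprK.
  exact/heckeN/heckeMS.
elim: k => [|k IH]; first by rewrite PM0_SM; exact: hecke_UM.
by rewrite -PM_SM_UM; exact: heckeMU.
Qed.

Lemma hecke_det A : hecke A -> det2 A = 1.
Proof.
elim=> [|{}A _ IH|{}A _ IH|{}A _ IH].
- by rewrite /det2 mat2_1 !mat2E; ring.
- by rewrite -IH /det2 !mxE; ring.
- by rewrite det2M IH /det2 !mat2E; ring.
- by rewrite det2M IH /det2 !mat2E; ring.
Qed.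

Lemma hecke_adj A : hecke A -> hecke (adj2 A).
Proof.
elim=> [|{}A _ IH|{}A _ IH|{}A _ IH].
- have -> : adj2 1%:M = 1%:M :> 'M[R]_2; last exact: hecke1.
  by rewrite mat2_1 /adj2 !mat2E oppr0.
- have -> : adj2 (- A) = - adj2 A; last exact: heckeN.
  by rewrite /adj2 !mxE opp_mat2.
- rewrite adj2M; apply: heckeM => //.
  have -> : adj2 SM = - SM; last exact/heckeN/hecke_SM.
  by rewrite /adj2 !mat2E opp_mat2; congr mat2; ring.
rewrite adj2M; apply: heckeM => //.
(* [PM (q-2) S = U^(q-1) = - U^-1] *)
have qE : q.-2.+1 = q.-1 by rewrite -subn2 -subn1 -subSn // (leq_trans _ hq).
suff -> : adj2 UM = - (PM q.-2 *m SM) by apply/heckeN/heckeMS/hecke_PM.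
rewrite -[RHS]mulmx1 -(mul_adj2 (A := UM)).
  by rewrite mulNmx mulmxA PM_SM_UM qE PM_last_SM mulNmx opprK mul1mx.
exact/hecke_det/hecke_UM.
Qed.

Lemma hecke_TM c : hecke (TM c).
Proof.
have T1 : TM 1 = PM 0.
  rewrite /TM /PM (sin_ratioSS 0) sin_ratio0 sin_ratio1; congr mat2; ring.
have TD c1 c2 : TM (c1 + c2) = TM c1 *m TM c2.
  by rewrite mul_mat2 /TM intrD; congr mat2; ring.
elim/int_ind: c => [|n IH|n IH].
- have -> : TM 0 = 1%:M; last exact: hecke1.
  by rewrite /TM mat2_1; congr mat2; ring.
- rewrite -addn1 PoszD TD T1; exact/heckeM/hecke_PM.
- rewrite -addn1 PoszD opprD TD; apply: heckeM => //.
  suff -> : TM (- 1) = adj2 (TM 1) by rewrite T1; apply/hecke_adj/hecke_PM.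
  by rewrite /TM /adj2 !mat2E; congr mat2; rewrite ?oppr0 ?intrN ?mulNr.
Qed.

(** Normal forms: descend from the edge {0, oo} through successive q-gons, on the side (0, oo), or
    on the other side if the word starts with [SM]. *)
Inductive chain : 'M[R]_2 -> Prop :=
| chain1 : chain 1%:M
| chainS : chain SM
| chainMP P k : (k.+1 < q)%N -> chain P -> chain (P *m PM k).

(** For k + 2 <= q all entries of [PM k] are nonnegative, and so are those of products of such
    factors. *)
Lemma chain_ge0 P : chain P ->
  exists2 Q : 'M[R]_2, (forall i j, 0 <= Q i j) & P = Q \/ P = SM *m Q.
Proof.
have one_ge0 (i j : 'I_2) : 0 <= (1%:M : 'M[R]_2) i j by rewrite mxE ler0n.
elim=> [||{}P k kq _ [Q Q0 PE]].
- by exists 1%:M => //; left.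
- by exists 1%:M => //; right; rewrite mulmx1.
exists (Q *m PM k); last first.
  by case: PE => ->; [left | right; rewrite mulmxA].
move=> i j; rewrite mxE sumr_ge0 // => l _; rewrite mulr_ge0 //.
rewrite mxE; do 2 case: ifP => _; apply: sin_ratio_ge0 => //;
  by rewrite ?(ltnW kq) // ltnW // ltnW.
Qed.

(** Appending [UM] opens a new factor [PM 0], or, after a trailing [SM], raises the last index k by
    one. When that index would become q - 1, the factor disappears because U^q = -1. *)
Lemma hecke_chain A : hecke A ->
  exists2 P, chain P & [\/ A = P, A = - P, A = P *m SM | A = - (P *m SM)].
Proof.
have q3 : (1 < q)%N by rewrite (leq_trans _ hq).
have PU P : chain P -> exists2 P', chain P' & P *m UM = P' *m SM.
  move=> cP; exists (P *m PM 0); first exact: chainMP.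
  by rewrite -mulmxA PM0_SM.
have PSU P : chain P -> exists2 P', chain P' &
    P *m SM *m UM = P' *m SM \/ P *m SM *m UM = - P'
    \/ P *m SM *m UM = - (P' *m SM).
  case=> [||{}P k kq cP].
  - have [P' cP' e] := PU _ chainS.
    by exists P' => //; left; rewrite mul1mx.
  - have [P' cP' e] := PU _ chain1; exists P' => //; right; right.
    by rewrite SM_SM -e mulNmx.
  - have -> : P *m PM k *m SM *m UM = P *m (PM k.+1 *m SM).
      by rewrite -PM_SM_UM !mulmxA.
    have [kq' | ] := ltnP k.+2 q.
      by exists (P *m PM k.+1); [exact: chainMP | left; rewrite mulmxA].
    rewrite leq_eqVlt ltnNge kq orbF => /eqP qE.
    by exists P => //; right; left; rewrite -[k.+1]/(k.+2.-1) -qE PM_last_SM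
      mulmxN mulmx1.
elim=> [|{}A _ [P cP PE]|{}A _ [P cP PE]|{}A _ [P cP PE]].
- by exists 1%:M; [exact: chain1 | constructor 1].
- exists P => //; case: PE => ->; rewrite ?opprK.
  + by constructor 2.
  + by constructor 1.
  + by constructor 4.
  + by constructor 3.
- exists P => //; case: PE => ->;
    rewrite ?mulNmx -?mulmxA ?SM_SM ?mulmxN ?mulmx1 ?opprK.
  + by constructor 3.
  + by constructor 4.
  + by constructor 2.
  + by constructor 1.
- case: PE => ->.
  + by have [P' cP' ->] := PU _ cP; exists P' => //; constructor 3.
  + by have [P' cP' e] := PU _ cP; exists P' => //; rewrite mulNmx e; constructor 4.
  + have [P' cP' e] := PSU _ cP; exists P' => //.
    by case: e => [->|[->|->]]; [constructor 3|constructor 2|constructor 4].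
  + have [P' cP' e] := PSU _ cP; exists P' => //; rewrite mulNmx.
    by case: e => [->|[->|->]]; rewrite ?opprK;
      [constructor 4|constructor 1|constructor 3].
Qed.

(* Edges of the Farey graph do not cross: A(0) and A(oo) are not separated by
   0 and oo. *)
Lemma hecke_noncrossing A : hecke A -> 0 <= A 0 0 * A 0 1 * (A 1 0 * A 1 1).
Proof.
case/hecke_chain => P /chain_ge0[Q Q0 PE] AE.
have {Q0} : 0 <= Q 0 0 * Q 0 1 * (Q 1 0 * Q 1 1) by rewrite !mulr_ge0.
(* The product of the four entries is invariant under a global sign and under multiplication by [SM]
   on either side. *)
suff -> : Q 0 0 * Q 0 1 * (Q 1 0 * Q 1 1) = A 0 0 * A 0 1 * (A 1 0 * A 1 1) by [].
rewrite (mat2_eta Q) in PE *.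
case: PE AE => -> [] ->; rewrite ?mul_mat2 ?opp_mat2 ?mul_mat2 ?opp_mat2 !mat2E; ring.
Qed.

End HeckeGroup.

(** * Convergents as columns of Hecke matrices *)

Section Convergents.
Local Open Scope classical_set_scope.
Local Open Scope ring_scope.
Variables (R : realType) (q : nat) (b : nat -> int).
Hypothesis hq : (3 <= q)%N.
Hypothesis hb : forall x : one_point_compactification R,
  ~ occurs_infinitely_often q b x.
Implicit Types g h : 'M[R]_2.

Local Notation lam := (rosen_lambda R q).
Local Notation s := (sin_ratio R q).

(** Homogeneous coordinates turn [rosen_map q c] into the linear action of [TM R q c *m SM R]. *)
Definition ratio_point (x y : R) : one_point_compactification R :=
  if y == 0 then None else Some (x / y).

Lemma rosen_map_ratio c x y : (x != 0) || (y != 0) ->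
  rosen_map q c (ratio_point x y) = ratio_point (c%:~R * lam * x - y) x.
Proof.
rewrite /ratio_point; case: (eqVneq y 0) => [-> /=|y0 _] /=.
  by rewrite orbF => x0; rewrite (negbTE x0) subr0 mulfK.
rewrite mulf_eq0 invr_eq0 (negbTE y0) orbF.
by case: (eqVneq x 0) => // x0; congr Some; field; apply/andP.
Qed.

Definition cf_mx m : 'M[R]_2 :=
  \big[mulmx/1%:M]_(1 <= i < m.+1) (TM R q (b i) *m SM R).

Lemma hecke_cf_mx m : hecke q (cf_mx m).
Proof.
rewrite /cf_mx; elim/big_ind: _ => [|g h|i _].
- exact: hecke1.
- exact: heckeM.
- exact/heckeMS/hecke_TM.
Qed.

Lemma det2_neq0 g : det2 g = 1 -> (g 0 0 != 0) || (g 1 0 != 0).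
Proof.
rewrite /det2 -negb_and; apply: contra_eqN => /andP[/eqP-> /eqP->].
by rewrite mul0r mulr0 subr0 eq_sym oner_eq0.
Qed.

Lemma rosen_convergentE m :
  rosen_convergent R q b m = ratio_point (cf_mx m 0 0) (cf_mx m 1 0).
Proof.
rewrite /rosen_convergent /cf_mx.
elim: (index_iota _ _) => [|i r IH].
  by rewrite !big_nil mat2_1 !mat2E /ratio_point eqxx.
rewrite !big_cons /= IH; set g := \big[_/_]_(_ <- _) _.
have hg : hecke q g.
  rewrite /g; elim/big_ind: _ => [|*|*]; first exact: hecke1.
    exact: heckeM.
  exact/heckeMS/hecke_TM.
rewrite rosen_map_ratio; last exact/det2_neq0/(hecke_det hg).
by rewrite (mat2_eta g) !mul_mat2 !mat2E; congr ratio_point; ring.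
Qed.

Lemma cf_mxS m : cf_mx m.+1 = cf_mx m *m (TM R q (b m.+1) *m SM R).
Proof. exact: (@big_nat_recr 'M[R]_2 1 *%R _ 1). Qed.

(** * The side of a Farey edge on which the convergents eventually stay *)

Lemma avoids_near (x : one_point_compactification R) :
  \forall m \near \oo, rosen_convergent R q b m <> x.
Proof.
have /contrapT/finite_seqP[r rE] := @hb x.
near=> m => mx.
have : m \in r.
  have : [set m | (0 < m)%N /\ rosen_convergent R q b m = x] m.
    by split => //; near: m; exact: nbhs_infty_gt.
  by rewrite rE.
move/(@leq_bigmax_seq _ r xpredT id m) => /(_ isT).
by apply/negP; rewrite -ltnNge; near: m; exact: nbhs_infty_gt.
Unshelve. all: by end_near. Qed.

(** The form vanishes at a single point of the circle, -d/c or oo, and by [hb] the convergents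
    eventually avoid it. *)
Lemma linear_form_neq0_near c d : (c != 0) || (d != 0) ->
  \forall m \near \oo, c * cf_mx m 0 0 + d * cf_mx m 1 0 != 0.
Proof.
move=> cd; have [c0|c0] := eqVneq c 0.
  rewrite c0 eqxx /= in cd *.
  near=> m; rewrite mul0r add0r mulf_neq0 //; apply/eqP => q0.
  have : rosen_convergent R q b m <> None by near: m; exact: avoids_near.
  by rewrite rosen_convergentE /ratio_point q0 eqxx.
near=> m; apply/eqP => e.
have : rosen_convergent R q b m <> Some (- d / c) by near: m; exact: avoids_near.
rewrite rosen_convergentE /ratio_point.
case: eqP => [q0|/eqP q0].
  move: e; rewrite q0 mulr0 addr0 => /eqP; rewrite mulf_eq0 (negbTE c0) /= => p0.
  by move: (det2_neq0 (hecke_det (hecke_cf_mx m))); rewrite p0 q0 eqxx.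
apply; congr Some; apply/eqP; rewrite eqr_div // mulrC; apply/eqP.
by move/eqP: e; rewrite addr_eq0 mulNr => /eqP.
Unshelve. all: by end_near. Qed.

(* The sign of [orient g m] tells in which of the two arcs cut off by the
   Farey edge with endpoints g^-1(0), g^-1(oo) the m-th convergent lies. *)
Definition orient g m := (g *m cf_mx m) 0 0 * (g *m cf_mx m) 1 0.

Lemma orientE g m : orient g m =
  (g 0 0 * cf_mx m 0 0 + g 0 1 * cf_mx m 1 0) *
  (g 1 0 * cf_mx m 0 0 + g 1 1 * cf_mx m 1 0).
Proof.
by rewrite /orient {1 2}(mat2_eta g) {1 2}(mat2_eta (cf_mx m)) mul_mat2 !mat2E.
Qed.

(** The columns of [cf_mx m.+1] are, up to sign, the convergents m+1 and m, so the product is that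
    of the four entries of [g *m cf_mx m.+1], and non-crossing applies. *)
Lemma orientS_ge0 g m : hecke q g -> 0 <= orient g m * orient g m.+1.
Proof.
move=> hg; have := hecke_noncrossing hq (heckeM hg (hecke_cf_mx m.+1)).
rewrite /orient cf_mxS; set B := g *m cf_mx m; rewrite mulmxA -/B.
rewrite (mat2_eta B) !mul_mat2 !mat2E; congr (0 <= _); ring.
Qed.

Lemma orient_near g : hecke q g ->
  (\forall m \near \oo, 0 < orient g m) \/ (\forall m \near \oo, orient g m < 0).
Proof.
move=> hg; have dg := hecke_det hg.
have row0 : (g 0 0 != 0) || (g 0 1 != 0).
  apply: contra_eqT dg; rewrite negb_or !negbK => /andP[/eqP g0 /eqP g1].
  by rewrite /det2 g0 g1 !mul0r subr0 eq_sym oner_eq0.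
have row1 : (g 1 0 != 0) || (g 1 1 != 0).
  apply: contra_eqT dg; rewrite negb_or !negbK => /andP[/eqP g0 /eqP g1].
  by rewrite /det2 g0 g1 !mulr0 subr0 eq_sym oner_eq0.
have [N _ Nneq0] : \forall m \near \oo, orient g m != 0.
  near=> m; rewrite orientE mulf_neq0 //.
    by near: m; exact: linear_form_neq0_near.
  by near: m; exact: linear_form_neq0_near.
have := Nneq0 N (leqnn N); rewrite /= neq_lt => /orP[neg|pos]; [right|left].
  exists N => // m /= /subnK <-; elim: (m - N)%N => // k IH.
  have := orientS_ge0 (k + N) hg; have := Nneq0 (k.+1 + N)%N (leq_addl _ _).
  by rewrite /= addSn nmulr_rge0 // le_eqVlt => /negbTE -> /=.
exists N => // m /= /subnK <-; elim: (m - N)%N => // k IH.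
have := orientS_ge0 (k + N) hg; have := Nneq0 (k.+1 + N)%N (leq_addl _ _).
by rewrite /= addSn pmulr_rge0 // le_eqVlt eq_sym => /negbTE -> /=.
Unshelve. all: by end_near. Qed.

(** A point of (0, oo) that is not a vertex of the q-gon lies in one of the q - 1 subarcs;
    [orient_near] makes the choice of subarc eventually constant. *)
Lemma orient_refine h : hecke q h -> (\forall m \near \oo, 0 < orient h m) ->
  exists2 k, (k.+1 < q)%N &
    \forall m \near \oo, 0 < orient (adj2 (PM R q k) *m h) m.
Proof.
move=> hh h0; apply: contrapT => no.
pose x m := (h *m cf_mx m) 0 0; pose y m := (h *m cf_mx m) 1 0.
(* [l k m] vanishes when x/y is the vertex U^k(oo). If no subarc captured the convergents, all
   [l k m] would share one sign, yet [l 0 m] is y, [l q.-1 m] is -x, and xy > 0. *)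
pose l k m := s k.+1 * y m - s k * x m.
have orientl k m : orient (adj2 (PM R q k) *m h) m = - (l k m * l k.+1 m).
  rewrite /orient /l /x /y -mulmxA; set B := h *m _.
  by rewrite (mat2_eta B) mul_mat2 !mat2E; ring.
have adj k : (k.+1 < q)%N -> \forall m \near \oo, 0 < l k m * l k.+1 m.
  move=> kq.
  have hk : hecke q (adj2 (PM R q k) *m h) by exact/heckeM/hh/hecke_adj/hecke_PM.
  have [pos|neg] := orient_near hk; first by case: no; exists k.
  by near=> m; rewrite -oppr_lt0 -orientl; near: m.
have all_same k : (k < q)%N -> \forall m \near \oo, 0 < l 0 m * l k m.
  elim: k => [|k IH] kq.
    near=> m; rewrite -expr2 lt_neqAle sqr_ge0 andbT eq_sym sqrf_eq0.
    have : 0 < orient h m by near: m.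
    rewrite /l sin_ratio0 sin_ratio1 // mul1r mul0r subr0 /orient -/(x m) -/(y m).
    by apply: contraTN => /eqP ->; rewrite mulr0 ltxx.
  near=> m.
  have l0k : 0 < l 0 m * l k m by near: m; exact/IH/ltnW.
  have lk : 0 < l k m * l k.+1 m by near: m; exact: adj.
  have := mulr_gt0 l0k lk.
  have -> : l 0 m * l k m * (l k m * l k.+1 m) =
    (l k m ^+ 2) * (l 0 m * l k.+1 m) by ring.
  rewrite pmulr_rgt0 // lt_neqAle sqr_ge0 andbT eq_sym sqrf_eq0.
  by apply: contraTN l0k => /eqP ->; rewrite mulr0 ltxx.
have q1 : (q.-1 < q)%N by rewrite ltn_predL (leq_trans _ hq).
have : \forall m \near \oo, False.
  near=> m.
  have : 0 < orient h m by near: m.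
  have : 0 < l 0 m * l q.-1 m by near: m; exact: all_same.
  rewrite /l sin_ratio0 sin_ratio1 // prednK ?(leq_trans _ hq) //.
  rewrite sin_ratio_q // sin_ratio_pred // /orient -/(x m) -/(y m).
  by move: (x m) (y m) => u v; nra.
by case=> N _ /(_ N (leqnn N)).
Unshelve. all: by end_near. Qed.

(** The bottom row of [g] holds the denominators of the ends of the arc. Each refinement keeps both
    at least 1 and raises their sum by at least 1. *)
Lemma zoom g : hecke q g -> 1 <= g 1 0 -> 1 <= g 1 1 ->
  (\forall m \near \oo, 0 < orient (adj2 g) m) -> forall n : nat,
  exists g', [/\ hecke q g', 1 <= g' 1 0, 1 <= g' 1 1,
    n%:R <= g' 1 0 + g' 1 1 & \forall m \near \oo, 0 < orient (adj2 g') m].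
Proof.
move=> hg c1 d1 og; elim=> [|n [{c1 d1 og}g' [hg' c1 d1 cd og]]].
  by exists g; split => //; rewrite addr_ge0 // (le_trans ler01).
have [k kq ok] := orient_refine (hecke_adj hq hg') og.
exists (g' *m PM R q k); rewrite adj2M.
have [sk1 sk sk2] : [/\ 1 <= s k.+1, 0 <= s k & 0 <= s k.+2].
  by split; [exact: sin_ratio_ge1 | |]; apply: sin_ratio_ge0 => //;
    rewrite ltnW // ltnW.
(* One of the two can vanish, at k = 0 or k = q - 2, but not both, as q >= 3. *)
have : 1 <= s k \/ 1 <= s k.+2.
  case: k {ok sk1 sk sk2} kq => [kq|k kq].
    by right; exact: sin_ratio_ge1.
  by left; apply: sin_ratio_ge1 => //; exact: ltnW.
have -> : (g' *m PM R q k) 1 0 = g' 1 0 * s k.+1 + g' 1 1 * s k.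
  by rewrite {1}(mat2_eta g') mul_mat2 !mat2E.
have -> : (g' *m PM R q k) 1 1 = g' 1 0 * s k.+2 + g' 1 1 * s k.+1.
  by rewrite {1}(mat2_eta g') mul_mat2 !mat2E.
move=> uw; split => //; first exact: heckeM hg' (hecke_PM _ hq _).
all: move: (g' 1 0) (g' 1 1) (s k) (s k.+1) (s k.+2) c1 d1 sk1 sk sk2 cd uw
  => c d u w x c1 d1 w1 u0 x0 cd [?|?]; rewrite -?natr1; nra.
Qed.

Lemma orient_adj_arc g v : det2 g = 1 -> 1 <= g 1 0 -> 1 <= g 1 1 ->
  0 < (g 1 1 * v - g 0 1) * (g 0 0 - g 1 0 * v) ->
  0 <= v - g 0 1 / g 1 1 <= (g 1 0 * g 1 1)^-1.
Proof.
rewrite /det2; move: (g 0 0) (g 0 1) (g 1 0) (g 1 1) => a b' c d det c1 d1 h.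
have d0 : 0 < d by lra.
have c0 : 0 < c by lra.
(* The determinant gives c (d v - b') + d (a - c v) = 1. Hence the two factors, of equal sign, are
   positive, and c (d v - b') <= 1. *)
have [u0 t0] : 0 < d * v - b' /\ 0 < a - c * v.
  suff u0 : 0 < d * v - b' by rewrite pmulr_rgt0 in h.
  rewrite ltNge; apply/negP => u0.
  have t0 : a - c * v < 0 by rewrite ltNge; apply/negP => t0; nra.
  nra.
have -> : v - b' / d = (d * v - b') / d by field; rewrite gt_eqF.
rewrite divr_ge0 ?(ltW u0) ?(ltW d0) //=.
have -> : (c * d)^-1 = c^-1 / d by field; rewrite !gt_eqF.
rewrite ler_pM2r ?invr_gt0 //.
by rewrite -[X in _ <= X]mul1r ler_pdivlMr //; nra.
Qed.

(** At a zero denominator this is 0 while the convergent is oo; that stops happening for large m. *)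
Let v m := cf_mx m 0 0 / cf_mx m 1 0.

Lemma rosen_convergent_some :
  \forall m \near \oo, cf_mx m 1 0 != 0 /\ rosen_convergent R q b m = Some (v m).
Proof.
near=> m.
have q0 : cf_mx m 1 0 != 0.
  have : 0 * cf_mx m 0 0 + 1 * cf_mx m 1 0 != 0.
    by near: m; apply: linear_form_neq0_near; rewrite oner_eq0 orbT.
  by rewrite mul0r mul1r add0r.
by split => //; rewrite rosen_convergentE /ratio_point (negbTE q0).
Unshelve. all: by end_near. Qed.

Lemma orient_adj_cvg g : hecke q g -> 1 <= g 1 0 -> 1 <= g 1 1 ->
  (\forall m \near \oo, 0 < orient (adj2 g) m) -> rosen_converges R q b.
Proof.
move=> hg c1 d1 og.
have : cauchy (v @ \oo).
  apply: cauchy_exP => e e0.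
  (* For c, d >= 1, cd >= c + d - 1; the successor absorbs this 1, so that 1/(cd) < e. *)
  have [g' [hg' {c1 d1 og}c1 d1 cd og]] := zoom hg c1 d1 og (Num.bound e^-1).+1.
  exists (g' 0 1 / g' 1 1); rewrite /= nbhs_simpl /=.
  near=> m; rewrite /= -ball_normE /= distrC.
  have [q0 _] : cf_mx m 1 0 != 0 /\ rosen_convergent R q b m = Some (v m).
    by near: m; exact: rosen_convergent_some.
  have o0 : 0 < orient (adj2 g') m by near: m.
  have /andP[v0 vle] : 0 <= v m - g' 0 1 / g' 1 1 <= (g' 1 0 * g' 1 1)^-1.
    apply: orient_adj_arc (hecke_det hg') c1 d1 _.
    have -> : (g' 1 1 * v m - g' 0 1) * (g' 0 0 - g' 1 0 * v m) =
      orient (adj2 g') m / (cf_mx m 1 0) ^+ 2.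
      by rewrite orientE !mat2E /v; field.
    by rewrite divr_gt0 // lt_neqAle sqr_ge0 andbT eq_sym sqrf_eq0.
  have einv : e^-1 < (Num.bound e^-1)%:R by rewrite archi_boundP // invr_ge0 ltW.
  have cdle : e^-1 < g' 1 0 * g' 1 1.
    move: cd einv c1 d1; rewrite -natr1; move: (g' 1 0) (g' 1 1) => c d.
    move=> cd en c1 d1; have : 0 <= (c - 1) * (d - 1) by rewrite mulr_ge0 ?subr_ge0.
    by lra.
  rewrite ger0_norm // (le_lt_trans vle) // -[e]invrK ltf_pV2 // posrE.
    by rewrite mulr_gt0 // (lt_le_trans ltr01).
  by rewrite invr_gt0.
move/cauchy_cvg/cvg_ex => [l vl].
apply/cvg_ex; exists (Some l).
apply: (@cvg_trans _ ((Some \o v : nat -> one_point_compactification R) @ \oo)).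
  apply: near_eq_cvg; near=> m.
  have [_ ->//] : cf_mx m 1 0 != 0 /\ rosen_convergent R q b m = Some (v m).
  by near: m; exact: rosen_convergent_some.
by apply: cvg_comp vl _; exact: one_point_compactification_some_continuous.
Unshelve. all: by end_near. Qed.

(** * Convergence to oo, and the final case distinction *)

Lemma unbounded_cvg :
  (forall M, \forall m \near \oo, M < `|v m|) -> rosen_converges R q b.
Proof.
move=> unb; apply/cvg_ex; exists None => U /= [C [cptC _] CU].
have [M [_ CM]] := compact_bounded cptC.
rewrite /= nbhs_simpl /=.
near=> m; apply: CU; left; exists (v m).
  move=> /(CM (M + 1)); rewrite ltrDl ltr01 => /(_ isT) /=.
  by apply/negP; rewrite -ltNge; near: m; exact: unb.
have [_ ->//] : cf_mx m 1 0 != 0 /\ rosen_convergent R q b m = Some (v m).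
by near: m; exact: rosen_convergent_some.
Unshelve. all: by end_near. Qed.

Lemma orient_TM m j : orient (TM R q j) m =
  (cf_mx m 0 0 + j%:~R * lam * cf_mx m 1 0) * cf_mx m 1 0.
Proof. by rewrite orientE !mat2E; ring. Qed.

Lemma lam_ge1 : 1 <= lam.
Proof.
have := sin_ratio_ge1 R hq hq.
by rewrite (sin_ratioSS R q 0) sin_ratio0 sin_ratio1 // subr0 mulr1.
Qed.

Lemma rosen_converges_of_avoiding : rosen_converges R q b.
Proof.
have l1 := lam_ge1.
(* [P j] says that eventually v m > -j lambda. If it holds for all j, v tends to plus infinity; if
   for none, to minus infinity. *)
pose P j := \forall m \near \oo, 0 < orient (TM R q j) m.
have nP j : ~ P j -> \forall m \near \oo, orient (TM R q j) m < 0.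
  by move=> nPj; have [|] := orient_near (hecke_TM R hq j).
have vE m j : cf_mx m 1 0 != 0 ->
    orient (TM R q j) m = (v m + j%:~R * lam) * cf_mx m 1 0 ^+ 2.
  by move=> q0; rewrite orient_TM /v; field.
have q2_gt0 m : cf_mx m 1 0 != 0 -> 0 < cf_mx m 1 0 ^+ 2.
  by move=> q0; rewrite lt_neqAle sqr_ge0 andbT eq_sym sqrf_eq0.
have big (M : R) : exists n : nat, `|M| < n%:R * lam.
  exists (Num.bound `|M|); apply: (@lt_le_trans _ _ (Num.bound `|M|)%:R).
    exact: archi_boundP.
  by rewrite ler_peMr.
have [allP|/existsNP[i nPi]] := pselect (forall j, P j).
  apply: unbounded_cvg => M; have [n Mn] := big M.
  near=> m.
  have [q0 _] : cf_mx m 1 0 != 0 /\ rosen_convergent R q b m = Some (v m).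
    by near: m; exact: rosen_convergent_some.
  have : 0 < orient (TM R q (- n%:Z)) m by near: m; exact: allP.
  rewrite vE // pmulr_lgt0 ?q2_gt0 // intrN mulNr subr_gt0 => nv.
  exact: le_lt_trans (ler_norm M) (lt_le_trans (lt_trans Mn nv) (ler_norm _)).
have [allnP|/existsNP[j /contrapT Pj]] := pselect (forall j, ~ P j).
  apply: unbounded_cvg => M; have [n Mn] := big M.
  near=> m.
  have [q0 _] : cf_mx m 1 0 != 0 /\ rosen_convergent R q b m = Some (v m).
    by near: m; exact: rosen_convergent_some.
  have : orient (TM R q n%:Z) m < 0 by near: m; exact/nP/allnP.
  rewrite vE // pmulr_llt0 ?q2_gt0 // => nv.
  rewrite -normrN (le_lt_trans (ler_norm M)) // (lt_le_trans _ (ler_norm _)) //.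
  by rewrite (lt_trans Mn) // -subr_lt0 opprK addrC.
(* Walking up from i, where [P] fails, must meet a switch before j; j < i is impossible, as [P j]
   implies [P i]. *)
have [k nPk Pk] : exists2 k, ~ P k & P (k + 1).
  apply: contrapT => no.
  have up n : ~ P (i + n%:Z).
    elim: n => [|n IH]; first by rewrite addr0.
    by move=> Pn; apply: no; exists (i + n%:Z) => //; rewrite -addrA -PoszD addn1.
  have [ij|ji] := leP i j.
    have := up `|j - i|%N; rewrite gez0_abs ?subr_ge0 // addrCA subrr addr0; exact.
  have [N _ {nPi}Ni] := nP _ nPi; case: Pj => N' _ Nj.
  have [N'' _ Nq] := rosen_convergent_some.
  pose m := maxn N (maxn N' N'').
  have [q0 _] := Nq m (leq_trans (leq_maxr _ _) (leq_maxr _ _)).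
  have := Ni m (leq_maxl _ _).
  have := Nj m (leq_trans (leq_maxl _ _) (leq_maxr _ _)).
  rewrite /= !vE // pmulr_lgt0 ?q2_gt0 // pmulr_llt0 ?q2_gt0 //.
  by rewrite -(ltr_int R) in ji; nra.
have [k' kq ok'] := orient_refine (hecke_TM R hq (k + 1)) Pk.
(* The subarc with index 0 is (lambda, oo), which would give [P k]. Every other subarc has both
   denominators at least 1, as [orient_adj_cvg] requires. *)
have ad : adj2 (PM R q 0) *m TM R q (k + 1) = TM R q k.
  rewrite /adj2 !mat2E mul_mat2 (sin_ratioSS R q 0) sin_ratio0 sin_ratio1 //.
  by rewrite /TM intrD; congr mat2; ring.
case: k' kq ok' => [|k'] kq ok'; first by rewrite ad in ok'.
have TN : adj2 (TM R q (- (k + 1))) = TM R q (k + 1).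
  by rewrite /adj2 !mat2E /TM !intrN; congr mat2; ring.
apply: (@orient_adj_cvg (TM R q (- (k + 1)) *m PM R q k'.+1)).
- exact: heckeM (hecke_TM _ hq _) (hecke_PM _ hq _).
- by rewrite mul_mat2 !mat2E mul0r add0r mul1r sin_ratio_ge1 // ltnW.
- by rewrite mul_mat2 !mat2E mul0r add0r mul1r sin_ratio_ge1.
- by rewrite adj2M TN.
Unshelve. all: by end_near. Qed.

End Convergents.

Theorem theorem13 (R : realType) (q : nat) (hq : (3 <= q)%N) (b : nat -> int)
    (hb : forall x : one_point_compactification R,
      ~ occurs_infinitely_often q b x) :
  rosen_converges R q b.
Proof. exact: rosen_converges_of_avoiding. Qed.
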